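(* Let $X \subset \mathbb R^n$ be a regular convex set and $f$ a projectively self-concordant barrier on $X$ with parameter $\gamma$. Let $q: \mathbb R^n \to \mathbb R$ be an affine-linear function and $A: \mathbb R^n \to \mathbb R^n$ an affine-linear isomorphism, such that there is no point at which $q$ and $A$ vanish simultaneously. Define \[ \tilde X = \left\{ \left. \frac{A(x)}{q(x)} \,\right|\, x \in X,\ q(x) > 0 \right\} \] and assume that this set is a regular convex set. Then the function $\tilde f: \tilde X^o \to \mathbb R$ defined by \[ \tilde f\left(\frac{A(x)}{q(x)}\right) = f(x) + \log q(x),\qquad x \in X^o,\ q(x)>0, \] is a projectively self-concordant barrier on $\tilde X$ with parameter $\gamma$.
   Context: A regular convex set $X \subset \mathbb R^n$ is a closed convex set with non-empty interior $X^o$ containing no lines; $\partial X$ is its boundary. A projectively self-concordant barrier on $X$ with parameter $\gamma \geq 0$ is a $C^3$ function $f: X^o \to \mathbb R$ such that: (1) $f''(x) - f'(x)f'(x)^T \succ 0$ (positive definite) for all $x \in X^o$; (2) $\lim_{x \to\partial X} f(x) = +\infty$, i.e. $f(x_k)\to+\infty$ whenever $x_k \in X^o$ converges to a point of $\partial X$; (3) $|f'''(x)[h,h,h] - 6f''(x)[h,h]f'(x)[h] + 4(f'(x)[h])^3| \leq 2\gamma(f''(x)[h,h] - (f'(x)[h])^2)^{3/2}$ for all $x \in X^o$, $h \in \mathbb R^n$. *)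

(* Defs.v *)
From HB Require Import structures.
From mathcomp Require Import all_boot all_order all_algebra.
From mathcomp Require Import all_classical all_reals all_analysis.

Set Implicit Arguments.
Unset Strict Implicit.
Unset Printing Implicit Defensive.

Import Order.TTheory GRing.Theory Num.Theory.
Import numFieldNormedType.Exports.

Local Open Scope classical_set_scope.
Local Open Scope ring_scope.

Definition boundary (T : topologicalType) (X : set T) : set T :=
  closure X `\` X°.

Definition contains_line (R : realType) (V : lmodType R) (X : set V) : Prop :=
  exists x v : V, v != 0 /\ forall t : R, X (x + t *: v).

Definition regular_convex (R : realType) (n : nat) (X : set 'cV[R]_n) : Prop :=
  [/\ closed X,
      convex_set (X : set (convex_lmodType 'cV[R]_n)),
      X° !=set0
    & ~ contains_line X].

(* Continuous differentiability of order k on an open set U.  In finite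
   dimension the differential of f is of class C^k as soon as every
   directional derivative 'D_v f is.  Only the values of f on U matter. *)
Fixpoint Ck (R : realType) (n : nat) (k : nat) (U : set 'cV[R]_n)
    (f : 'cV[R]_n -> R) : Prop :=
  match k with
  | 0%N => forall x, U x -> {for x, continuous f}
  | k'.+1 => (forall x, U x -> differentiable f x) /\
             (forall v : 'cV[R]_n, Ck k' U ('D_v f))
  end.

Definition gradient (R : realType) (n : nat) (f : 'cV[R]_n -> R)
    (x : 'cV[R]_n) : 'cV[R]_n :=
  \col_(i < n) 'D_(delta_mx i 0) f x.

Definition hessian (R : realType) (n : nat) (f : 'cV[R]_n -> R)
    (x : 'cV[R]_n) : 'M[R]_n :=
  \matrix_(i < n, j < n) 'D_(delta_mx i 0) ('D_(delta_mx j 0) f) x.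

Definition posdefmx (R : realType) (n : nat) (M : 'M[R]_n) : Prop :=
  M^T = M /\ forall h : 'cV[R]_n, h != 0 -> 0 < (h^T *m M *m h) 0 0.

(* f'(x)[h], f''(x)[h,h] and f'''(x)[h,h,h] are the iterated directional
   derivatives of f along h.  The value of f outside the interior of X is
   irrelevant. *)
Definition psc_barrier (R : realType) (n : nat) (X : set 'cV[R]_n)
    (f : 'cV[R]_n -> R) (gamma : R) : Prop :=
  0 <= gamma /\
  [/\ Ck 3 X° f,
      forall x : 'cV[R]_n, X° x ->
        posdefmx (hessian f x - gradient f x *m (gradient f x)^T),
      forall (u : nat -> 'cV[R]_n) (x : 'cV[R]_n),
        (forall k, X° (u k)) -> boundary X x -> u k @[k --> \oo] --> x ->
        f (u k) @[k --> \oo] --> +oo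
    & forall x h : 'cV[R]_n, X° x ->
        let f1 := 'D_h f x in
        let f2 := 'D_h ('D_h f) x in
        let f3 := 'D_h ('D_h ('D_h f)) x in
        `|f3 - 6 * f2 * f1 + 4 * f1 ^+ 3|
          <= 2 * gamma * (f2 - f1 ^+ 2) `^ (3 / 2)].

Definition affine_linear (R : realType) (U V : lmodType R) (F : U -> V) : Prop :=
  exists (L : {linear U -> V}) (b : V), forall x, F x = L x + b.

Definition proj_map (R : realType) (n : nat) (A : 'cV[R]_n -> 'cV[R]_n)
    (q : 'cV[R]_n -> R) (x : 'cV[R]_n) : 'cV[R]_n :=
  (q x)^-1 *: A x.

Definition proj_image (R : realType) (n : nat) (A : 'cV[R]_n -> 'cV[R]_n)
    (q : 'cV[R]_n -> R) (X : set 'cV[R]_n) : set 'cV[R]_n :=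
  [set proj_map A q x | x in [set x | X x /\ 0 < q x]].

(* g is the function A(x)/q(x) |-> f(x) + log q(x); the points A(x)/q(x) with
   x in the interior of X and q(x) > 0 fill the interior of proj_image A q X,
   and g is unconstrained elsewhere. *)
Definition is_proj_transform (R : realType) (n : nat)
    (A : 'cV[R]_n -> 'cV[R]_n) (q : 'cV[R]_n -> R) (X : set 'cV[R]_n)
    (f g : 'cV[R]_n -> R) : Prop :=
  forall x, X° x -> 0 < q x -> g (proj_map A q x) = f x + ln (q x).

(* Main.v *)
(* The inverse of a projective map x |-> A(x)/q(x) is again of the form
   psi(z) = x0 + M z / r(z) with M linear and r = 1/q affine, so that the
   transform is g = f o psi - log r.  Along a line z + t k the map psi runs
   through the line psi(z) + tau h, where tau = t / (1 + rho t),
   rho = r'(k) / r(z) and h = psi'(z)[k].  Writing f1, f2, f3 for the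
   derivatives of f along h, those of g along k are
     f1 - rho,  f2 - 2 rho f1 + rho^2,  f3 - 6 rho f2 + 6 rho^2 f1 - 2 rho^3,
   and the expressions f2 - f1^2 and f3 - 6 f2 f1 + 4 f1^3 do not depend on rho.
   At a boundary point of the image, which lies in the image because the latter
   is closed, log r stays bounded and psi tends to a boundary point of X. *)
Require Import Defs.
From HB Require Import structures.
From mathcomp Require Import all_boot all_order all_algebra.
From mathcomp Require Import all_classical all_reals all_analysis.
From mathcomp Require Import ring.

Set Implicit Arguments.
Unset Strict Implicit.
Unset Printing Implicit Defensive.

Import Order.TTheory GRing.Theory Num.Theory.
Import numFieldNormedType.Exports.

Local Open Scope classical_set_scope.
Local Open Scope ring_scope.

(** * Calculus on column vectors *)

Lemma cV_sum_delta (R : pzSemiRingType) (n : nat) (v : 'cV[R]_n) :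
  v = \sum_i v i 0 *: delta_mx i 0.
Proof.
rewrite {1}[v]matrix_sum_delta; apply: eq_bigr => i _.
by rewrite big_ord1.
Qed.

Lemma linear_cV_differentiable (R : realType) (n : nat) (W : normedModType R)
    (L : {linear 'cV[R]_n -> W}) (x : 'cV[R]_n) : differentiable L x.
Proof.
rewrite (_ : (L : _ -> _) =
    \sum_(i < n) (fun z : 'cV[R]_n => z i 0 *: L (delta_mx i 0))); last first.
  apply/funext => z; rewrite fct_sumE [in LHS](cV_sum_delta z) linear_sum.
  by apply: eq_bigr => i _; rewrite linearZ.
apply: differentiable_sum => i; apply: differentiableZl => //.
exact: differentiable_coord.
Qed.

Lemma derive_linear_cV (R : realType) (n : nat) (W : normedModType R)
    (L : {linear 'cV[R]_n -> W}) (x v : 'cV[R]_n) : 'D_v L x = L v.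
Proof.
have dL := linear_cV_differentiable L.
by rewrite deriveE // diff_lin // => y; apply: differentiable_continuous.
Qed.

Lemma derive_sum_partial (R : realType) (n : nat) (f : 'cV[R]_n -> R)
    (x v : 'cV[R]_n) : differentiable f x ->
  'D_v f x = \sum_i v i 0 * 'D_(delta_mx i 0) f x.
Proof.
move=> df; rewrite deriveE // {1}(cV_sum_delta v) linear_sum.
by apply: eq_bigr => i _; rewrite linearZ deriveE.
Qed.

Lemma cvg_cV (R : realType) (n : nat) (T : Type) (F : set_system T)
    (FF : Filter F) (psi : T -> 'cV[R]_n) (y : 'cV[R]_n) :
  (forall i, psi z i 0 @[z --> F] --> y i 0) -> psi z @[z --> F] --> y.
Proof.
move=> h.
have -> : psi = fun z => \sum_i psi z i 0 *: delta_mx i 0.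
  by apply/funext => z; rewrite -cV_sum_delta.
rewrite (cV_sum_delta y).
apply: cvg_big => [|i _]; first exact: add_continuous.
by apply: cvgZr_tmp.
Qed.

Lemma differentiable_cV (R : realType) (n : nat) (V : normedModType R)
    (psi : V -> 'cV[R]_n) (z : V) :
  (forall i, differentiable (fun z => psi z i 0) z) -> differentiable psi z.
Proof.
move=> h.
have -> : psi = \sum_(i < n) (fun z => psi z i 0 *: delta_mx i 0).
  by apply/funext => y; rewrite fct_sumE -cV_sum_delta.
apply: differentiable_sum => i; apply: differentiableZl => //.
Qed.

Lemma derive_coord_cV (R : realType) (n : nat) (V : normedModType R)
    (psi : V -> 'cV[R]_n) (z v : V) (i : 'I_n) : differentiable psi z ->
  ('D_v psi z) i 0 = 'D_v (fun z => psi z i 0) z.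
Proof.
move=> d; rewrite derive_mx ?mxE //; exact: diff_derivable.
Qed.

Lemma derive_comp_cV (R : realType) (n : nat) (V : normedModType R)
    (psi : V -> 'cV[R]_n) (f : 'cV[R]_n -> R) (z v : V) :
  differentiable psi z -> differentiable f (psi z) ->
  'D_v (f \o psi) z =
  \sum_i 'D_v (fun z => psi z i 0) z * 'D_(delta_mx i 0) f (psi z).
Proof.
move=> dp df; rewrite deriveE; last exact: differentiable_comp.
rewrite diff_comp //= -!deriveE // derive_sum_partial //.
by apply: eq_bigr => i _; rewrite derive_coord_cV.
Qed.

(** * The classes C^k *)

(** Differentiability at a point is local: the differential of [f] satisfies the same first-order
    expansion for [g]. It is needed because all formulas below hold only on an open set [U]. *)
Lemma near_eq_differentiable (R : realType) (V W : normedModType R)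
    (f g : V -> W) (x : V) :
  (\near x, f x = g x) -> differentiable f x -> differentiable g x.
Proof.
move=> fg /diffP[cdf fE]; apply/diffP => /=.
(* The differential is a chosen linear map, so it suffices to exhibit one map with the required
   expansion. *)
apply: (@getPex _ (fun (df : {linear V -> W}) => continuous df /\
  forall y, g y = g (lim (nbhs x)) + df (y - lim (nbhs x))
                  +o_(y \near x) (y - lim (nbhs x)))).
exists ('d f x); split=> //.
move/funext/eqaddoP: fE; rewrite lim_id // => fE.
suff : g = (fun y => g x + 'd f x (y - x)) +o_x (fun y => y - x).
  by move=> {1}->; reflexivity.
have fgx := nbhs_singleton fg; apply/eqaddoP => e e0.
by apply: filterS2 (fE e e0) fg => y /[swap]; rewrite /= !fctE -fgx => ->.
Qed.

Section Ck_closure.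
Context {R : realType} {n : nat} (U : set 'cV[R]_n).
Hypothesis oU : open U.
Implicit Types (f g : 'cV[R]_n -> R) (x v : 'cV[R]_n).

Lemma eq_on_near f g : (forall x, U x -> f x = g x) ->
  forall x, U x -> \near x, f x = g x.
Proof.
by move=> fg x Ux; apply: filterS fg _; exact: open_nbhs_nbhs.
Qed.

Lemma eq_on_derive f g v : (forall x, U x -> f x = g x) ->
  forall x, U x -> 'D_v f x = 'D_v g x.
Proof. by move=> fg x Ux; apply/near_eq_derive/eq_on_near. Qed.

Lemma Ck_cst k (c : R) : Ck k U (fun=> c).
Proof.
elim: k c => [|k IH] c /=; first by move=> x _; exact: cst_continuous.
split=> [x _|v]; first exact: differentiable_cst.
rewrite (_ : 'D_v _ = fun=> 0) //.
by apply/funext => x; rewrite derive_cst.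
Qed.

Lemma CkW k f : Ck k.+1 U f -> Ck k U f.
Proof.
elim: k f => [|k IH] f /= [df Df].
  by move=> x Ux; exact/differentiable_continuous/df.
by split=> // v; apply/IH/Df.
Qed.

(** This lets a derivative be replaced by an explicit formula valid only on [U]; openness of [U]
    carries the equality over to all further derivatives. *)
Lemma Ck_eq k f g : (forall x, U x -> f x = g x) -> Ck k U f -> Ck k U g.
Proof.
elim: k f g => [|k IH] f g fg /=.
  move=> cf x Ux; have nfg := eq_on_near fg Ux.
  by apply: cvg_trans (near_eq_cvg nfg) _; rewrite -(fg _ Ux); exact: cf.
move=> [df Df]; split=> [x Ux|v].
  by apply: near_eq_differentiable (df x Ux); exact: eq_on_near.
by apply: IH (Df v); exact: eq_on_derive.
Qed.

Lemma CkD k f g : Ck k U f -> Ck k U g -> Ck k U (fun x => f x + g x).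
Proof.
elim: k f g => [|k IH] f g /=.
  by move=> cf cg x Ux; apply: continuousD; [exact: cf|exact: cg].
move=> [df Df] [dg Dg]; split=> [x Ux|v].
  by apply: differentiableD; [exact: df|exact: dg].
apply: Ck_eq (IH _ _ (Df v) (Dg v)) => x Ux /=.
by rewrite deriveD //; apply: diff_derivable; [exact: df|exact: dg].
Qed.

Lemma CkM k f g : Ck k U f -> Ck k U g -> Ck k U (fun x => f x * g x).
Proof.
elim: k f g => [|k IH] f g /=.
  by move=> cf cg x Ux; apply: continuousM; [exact: cf|exact: cg].
move=> Hf Hg; have [df Df] := Hf; have [dg Dg] := Hg; split=> [x Ux|v].
  by apply: differentiableM; [exact: df|exact: dg].
apply: Ck_eq (CkD (IH _ _ (CkW Hf) (Dg v)) (IH _ _ (CkW Hg) (Df v))) => x Ux /=.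
by rewrite deriveM //; apply: diff_derivable; [exact: df|exact: dg].
Qed.

Lemma Ck_sum (I : Type) (s : seq I) k (F : I -> 'cV[R]_n -> R) :
  (forall i, Ck k U (F i)) -> Ck k U (fun x => \sum_(i <- s) F i x).
Proof.
move=> h; elim: s => [|i s IH].
  by rewrite (_ : (fun _ => _) = fun=> 0); [exact: Ck_cst|
    apply/funext => x; rewrite big_nil].
rewrite (_ : (fun _ => _) = fun x => F i x + \sum_(j <- s) F j x).
  exact: CkD.
by apply/funext => x; rewrite big_cons.
Qed.

Lemma Ck_linear k (L : {linear 'cV[R]_n -> R^o}) : Ck k U L.
Proof.
case: k => [|k] /=.
  by move=> x _; apply/differentiable_continuous/linear_cV_differentiable.
split=> [x _|v]; first exact: linear_cV_differentiable.
rewrite (_ : 'D_v _ = fun=> L v); first exact: Ck_cst.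
by apply/funext => x; rewrite derive_linear_cV.
Qed.

(** The derivative of 1/f is -(1/f)(1/f)f', a product in which 1/f is already of class C^k by
    induction. *)
Lemma CkV k f : (forall x, U x -> f x != 0) -> Ck k U f ->
  Ck k U (fun x => (f x)^-1).
Proof.
move=> f0; elim: k => [|k IH] /=.
  by move=> cf x Ux; apply: continuousV; [exact: f0|exact: cf].
move=> Hf; have [df Df] := Hf; have IV := IH (CkW Hf).
split=> [x Ux|v]; first by apply: differentiableV; [exact: df|exact: f0].
apply: Ck_eq (CkM (Ck_cst k (-1)) (CkM (CkM IV IV) (Df v))) => x Ux.
rewrite deriveV ?f0 //; last exact/diff_derivable/df.
by rewrite /GRing.scale /= mulN1r mulNr expr2 invfM.
Qed.

Lemma derive_ln f x v : 0 < f x -> differentiable f x ->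
  'D_v (fun x => ln (f x)) x = (f x)^-1 * 'D_v f x.
Proof.
move=> fx df.
have dl : differentiable (@ln R) (f x).
  by apply/derivable1_diffP; have [] := is_derive1_ln fx.
rewrite deriveE; last exact: (differentiable_comp df dl).
rewrite diff_comp //= deriv1E; last exact/derivable1_diffP.
rewrite derive1E -deriveE //; have [_ ->] := is_derive1_ln fx.
by rewrite mulrC.
Qed.

(** A case analysis on [k] is enough: the first derivative f'/f contains no logarithm and is settled
    by [CkV] and [CkM]. *)
Lemma Ck_ln k f : (forall x, U x -> 0 < f x) -> Ck k U f ->
  Ck k U (fun x => ln (f x)).
Proof.
move=> f0; case: k => [|k] /= Hf.
  move=> x Ux; apply: continuous_comp; first exact: Hf.
  exact: continuous_ln (f0 _ Ux).
have [df Df] := Hf; split=> [x Ux|v].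
  apply: (@differentiable_comp _ _ _ _ f (@ln R)); first exact: df.
  by apply/derivable1_diffP; have [] := is_derive1_ln (f0 _ Ux).
have fV : Ck k U (fun x => (f x)^-1).
  by apply: CkV (CkW Hf) => x Ux; rewrite gt_eqF ?f0.
apply: Ck_eq (CkM fV (Df v)) => x Ux.
by rewrite derive_ln ?f0 //; exact: df.
Qed.

End Ck_closure.

Section Ck_composition.
Context {R : realType} {m n : nat}.
Variables (U : set 'cV[R]_m) (U' : set 'cV[R]_n).
Variable psi : 'cV[R]_m -> 'cV[R]_n.
Hypotheses (oU : open U) (psiU : forall z, U z -> U' (psi z)).

(** By the chain rule the derivative is a sum of products of a derivative of a coordinate of [psi]
    and a partial of [f] composed with [psi]. The latter is the induction hypothesis for the
    partial, so the induction is general in [f]. *)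
Lemma Ck_comp k (f : 'cV[R]_n -> R) :
  (forall i, Ck k U (fun z => psi z i 0)) -> Ck k U' f -> Ck k U (f \o psi).
Proof.
elim: k f => [|k IH] f /= hpsi.
  move=> cf z Uz; apply: continuous_comp; last exact/cf/psiU.
  by apply: (@cvg_cV _ _ _ (nbhs z)) => i; exact: hpsi.
move=> [df Df].
have dpsi z : U z -> differentiable psi z.
  by move=> Uz; apply: differentiable_cV => i; have [+ _] := hpsi i; apply.
split=> [z Uz|v].
  by apply: differentiable_comp (dpsi z Uz) (df _ (psiU Uz)).
pose G z := \sum_i 'D_v (fun z => psi z i 0) z * 'D_(delta_mx i 0) f (psi z).
apply: (@Ck_eq _ _ _ oU k G) => [z Uz|].
  by rewrite (derive_comp_cV v (dpsi z Uz) (df _ (psiU Uz))).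
apply: Ck_sum => // i; apply: CkM => //; first by have [_] := hpsi i; apply.
by apply: (IH ('D_(delta_mx i 0) f)) => // j; apply: CkW; exact: hpsi.
Qed.

End Ck_composition.

(** * Second derivatives of composites; restriction to lines *)

Section composition_symmetry.
Context {R : realType} {m n : nat}.
Variables (U : set 'cV[R]_m) (U' : set 'cV[R]_n).
Variable psi : 'cV[R]_m -> 'cV[R]_n.
Hypotheses (oU : open U) (psiU : forall z, U z -> U' (psi z)).
Hypothesis Cpsi : forall i, Ck 2 U (fun z => psi z i 0).

(** The first-order chain rule holds on all of [U], so it can be differentiated once more. *)
Lemma derive2_comp (f : 'cV[R]_n -> R) (u v z : 'cV[R]_m) :
  Ck 2 U' f -> U z ->
  'D_u ('D_v (f \o psi)) z =
  \sum_i 'D_u ('D_v (fun z => psi z i 0)) z * 'D_(delta_mx i 0) f (psi z) +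
  \sum_i \sum_j 'D_v (fun z => psi z i 0) z * 'D_u (fun z => psi z j 0) z *
     'D_(delta_mx j 0) ('D_(delta_mx i 0) f) (psi z).
Proof.
move=> [df Df] Uz.
have dpsi y : U y -> differentiable psi y.
  by move=> Uy; apply: differentiable_cV => i; have [+ _] := Cpsi i; apply.
pose a i y := 'D_v (fun z => psi z i 0) y.
pose b i y := 'D_(delta_mx i 0) f (psi y).
have da i : differentiable (a i) z.
  by have [_ /(_ v)[+ _]] := Cpsi i; apply.
have dDf i : differentiable ('D_(delta_mx i 0) f) (psi z).
  by have [+ _] := Df (delta_mx i 0); apply; exact: psiU.
have db i : differentiable (b i) z.
  by apply: differentiable_comp (dpsi z Uz) (dDf i).
rewrite (@eq_on_derive _ _ _ oU _ (\sum_i (fun y => a i y * b i y))) //;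
    last first.
  move=> y Uy; rewrite fct_sumE derive_comp_cV //; first exact: dpsi.
  exact/df/psiU.
rewrite derive_sum => [|i]; last first.
  by apply: derivableM; exact: diff_derivable.
rewrite -big_split /=; apply: eq_bigr => i _.
rewrite deriveM; [|exact: diff_derivable..].
rewrite /GRing.scale /= addrC [b i z * _]mulrC; congr (_ + _).
rewrite -[b i]/('D_(delta_mx i 0) f \o psi).
rewrite derive_comp_cV ?mulr_sumr //; last exact: dpsi.
by apply: eq_bigr => j _; rewrite mulrA.
Qed.

(** Symmetry of second derivatives is transported from [f] and the coordinates of [psi] to the
    composite, rather than deduced from their continuity. *)
Lemma derive2_comp_sym (f : 'cV[R]_n -> R) (u v z : 'cV[R]_m) :
  Ck 2 U' f -> U z ->
  (forall i, 'D_u ('D_v (fun z => psi z i 0)) z =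
             'D_v ('D_u (fun z => psi z i 0)) z) ->
  (forall i j, 'D_(delta_mx i 0) ('D_(delta_mx j 0) f) (psi z) =
               'D_(delta_mx j 0) ('D_(delta_mx i 0) f) (psi z)) ->
  'D_u ('D_v (f \o psi)) z = 'D_v ('D_u (f \o psi)) z.
Proof.
move=> Cf Uz psisym fsym.
(* Exchanging the two summation indices swaps the roles of [a] and [a']; the symmetry of [c]
   restores the order of its arguments. *)
have key (p p' b a a' : 'I_n -> R) (c : 'I_n -> 'I_n -> R) :
    (forall i, p i = p' i) -> (forall i j, c i j = c j i) ->
    \sum_i p i * b i + \sum_i \sum_j a i * a' j * c j i =
    \sum_i p' i * b i + \sum_i \sum_j a' i * a j * c j i.
  move=> pp cc; congr (_ + _); first by apply: eq_bigr => i _; rewrite pp.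
  rewrite exchange_big; apply: eq_bigr => i _; apply: eq_bigr => j _.
  by rewrite cc [X in X * _]mulrC.
rewrite (derive2_comp u v Cf Uz) (derive2_comp v u Cf Uz).
exact: (key (fun i => 'D_u ('D_v (fun z => psi z i 0)) z)
  (fun i => 'D_v ('D_u (fun z => psi z i 0)) z)
  (fun i => 'D_(delta_mx i 0) f (psi z)) (fun i => 'D_v (fun z => psi z i 0) z)
  (fun i => 'D_u (fun z => psi z i 0) z)
  (fun j i => 'D_(delta_mx j 0) ('D_(delta_mx i 0) f) (psi z)) psisym fsym).
Qed.

End composition_symmetry.

(** The difference quotient of the restriction to the line is the same function of the increment as
    the directional one. *)
Lemma is_derive_line (R : realType) (n : nat) (w : 'cV[R]_n -> R)
    (z v : 'cV[R]_n) (t : R) : differentiable w (z + t *: v) ->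
  is_derive t 1 (fun t => w (z + t *: v)) ('D_v w (z + t *: v)).
Proof.
move=> dw; have dv : derivable w (z + t *: v) v by exact: diff_derivable.
have E : (fun h : R => h^-1 *: (((fun t => w (z + t *: v)) \o shift t) (h *: 1)
    - w (z + t *: v))) =
    (fun h : R => h^-1 *: ((w \o shift (z + t *: v)) (h *: v)
    - w (z + t *: v))).
  apply/funext => h /=; congr (_ *: (w _ - _)).
  by rewrite /GRing.scale /= mulr1 -/(GRing.scale _ _) scalerDl addrCA.
by split; rewrite /derivable /derive E.
Qed.

(** * Derivatives under a fractional linear change of parameter on a line *)

Section fractional_linear_line.
Context {R : realType}.
Variables (T : set R) (rho c : R).
Hypotheses (oT : open T) (Tpos : forall t, T t -> 0 < 1 + rho * t).

Definition tau t := t / (1 + rho * t).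

Lemma is_derive_den (t : R) :
  is_derive t 1 (fun t => 1 + rho * t) rho.
Proof.
have h := is_deriveD (is_derive_cst (1 : R) t 1)
  (is_deriveZ rho (is_derive_id t 1)).
by apply: is_derive_eq h _; rewrite add0r /GRing.scale /= mulr1.
Qed.

Lemma is_derive_denV (t : R) : T t ->
  is_derive t 1 (fun t => (1 + rho * t)^-1) (- rho * (1 + rho * t) ^- 2).
Proof.
move=> Tt; have h := @is_deriveV _ (fun t => 1 + rho * t) _ _ _
  (lt0r_neq0 (Tpos Tt)) (is_derive_den t).
by apply: is_derive_eq h _; rewrite /GRing.scale /= mulNr mulNr mulrC.
Qed.

Lemma is_derive_tau (t : R) : T t ->
  is_derive t 1 tau ((1 + rho * t) ^- 2).
Proof.
move=> Tt; have h := is_deriveM (is_derive_id t 1) (is_derive_denV Tt).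
apply: is_derive_eq h _; rewrite /GRing.scale /=.
by have := lt0r_neq0 (Tpos Tt) => ?; field.
Qed.

(** An identity valid on the open set [T] may be differentiated; this is how each formula for a
    derivative of [G0] yields the next. *)
Lemma is_derive_unique (f g : R -> R) (t a b : R) : T t ->
  (forall t, T t -> f t = g t) -> is_derive t 1 f a -> is_derive t 1 g b ->
  a = b.
Proof.
move=> Tt fg fa gb.
have nfg : \near t, f t = g t by apply: filterS fg _; exact: open_nbhs_nbhs.
by have [_ <-] := near_eq_is_derive nfg fa; have [_ <-] := gb.
Qed.

Variables (F0 F1 F2 F3 G0 G1 G2 G3 : R -> R).
Hypothesis dF0 : forall t, T t -> is_derive (tau t) 1 F0 (F1 (tau t)).
Hypothesis dF1 : forall t, T t -> is_derive (tau t) 1 F1 (F2 (tau t)).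
Hypothesis dF2 : forall t, T t -> is_derive (tau t) 1 F2 (F3 (tau t)).
Hypothesis dG0 : forall t, T t -> is_derive t 1 G0 (G1 t).
Hypothesis dG1 : forall t, T t -> is_derive t 1 G1 (G2 t).
Hypothesis dG2 : forall t, T t -> is_derive t 1 G2 (G3 t).
Hypothesis GF : forall t, T t -> G0 t = F0 (tau t) - ln (1 + rho * t) + c.

Local Notation s t := ((1 + rho * t)^-1).

(** The functions [F1] to [F3] and [G1] to [G3] stand for iterated directional derivatives
    restricted to the two lines. This formula and the next two are stated on all of [T], not only at
    0, so that each of the first two can be differentiated to give its successor. *)
Lemma line_derive1 t : T t -> G1 t = s t ^+ 2 * F1 (tau t) - rho * s t.
Proof.
move=> Tt; apply: (is_derive_unique Tt GF); first exact: dG0.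
have h1 := is_derive1_comp (dF0 Tt) (is_derive_tau Tt).
have h2 := @is_derive1_comp _ (@ln R) (fun t => 1 + rho * t) _ _ _
  (is_derive1_ln (Tpos Tt)) (is_derive_den t).
have h := is_deriveD (is_deriveB h1 h2) (is_derive_cst c t 1).
apply: is_derive_eq h _.
by have := lt0r_neq0 (Tpos Tt) => ?; field.
Qed.

Lemma line_derive2 t : T t ->
  G2 t = s t ^+ 4 * F2 (tau t) - 2 * rho * s t ^+ 3 * F1 (tau t)
         + rho ^+ 2 * s t ^+ 2.
Proof.
move=> Tt; apply: (is_derive_unique Tt line_derive1); first exact: dG1.
have ds := is_derive_denV Tt.
have h1 := is_derive1_comp (dF1 Tt) (is_derive_tau Tt).
have h := is_deriveB (is_deriveM (is_deriveX 2 ds) h1) (is_deriveZ rho ds).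
apply: is_derive_eq h _; rewrite !fctE /GRing.scale /=.
by have := lt0r_neq0 (Tpos Tt) => ?; field.
Qed.

Lemma line_derive3 t : T t ->
  G3 t = s t ^+ 6 * F3 (tau t) - 6 * rho * s t ^+ 5 * F2 (tau t)
         + 6 * rho ^+ 2 * s t ^+ 4 * F1 (tau t) - 2 * rho ^+ 3 * s t ^+ 3.
Proof.
move=> Tt; apply: (is_derive_unique Tt line_derive2); first exact: dG2.
have ds := is_derive_denV Tt.
have h1 := is_derive1_comp (dF1 Tt) (is_derive_tau Tt).
have h2 := is_derive1_comp (dF2 Tt) (is_derive_tau Tt).
have h := is_deriveD (is_deriveB (is_deriveM (is_deriveX 4 ds) h2)
  (is_deriveM (is_deriveZ (2 * rho) (is_deriveX 3 ds)) h1))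
  (is_deriveZ (rho ^+ 2) (is_deriveX 2 ds)).
apply: is_derive_eq h _; rewrite !fctE /GRing.scale /= /GRing.scale /=.
by have := lt0r_neq0 (Tpos Tt) => ?; field.
Qed.

(** At t = 0 the parameter [tau] is 0 and every power of the denominator is 1. The values enter
    through equations because in the application the base point appears as [z + 0 *: k]. *)
Lemma line_derives_at0 f1 f2 f3 g1 g2 g3 : T 0 ->
  F1 0 = f1 -> F2 0 = f2 -> F3 0 = f3 -> G1 0 = g1 -> G2 0 = g2 -> G3 0 = g3 ->
  [/\ g1 = f1 - rho, g2 = f2 - 2 * rho * f1 + rho ^+ 2
    & g3 = f3 - 6 * rho * f2 + 6 * rho ^+ 2 * f1 - 2 * rho ^+ 3].
Proof.
move=> T0 <- <- <- <- <- <-.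
have := line_derive1 T0; have := line_derive2 T0; have := line_derive3 T0.
have -> : tau 0 = 0 by rewrite /tau mul0r.
by rewrite mulr0 addr0 invr1 !expr1n !mulr1 !mul1r => -> -> ->.
Qed.

End fractional_linear_line.

(** * Affine functions *)

(** This passes between the matrix form of the positivity condition and derivatives along a single
    direction, the only ones compared between [f] and its transform. *)
Lemma psc_form_quadratic (R : realType) (n : nat) (U : set 'cV[R]_n)
    (f : 'cV[R]_n -> R) (x h : 'cV[R]_n) : open U -> Ck 2 U f -> U x ->
  (h^T *m (hessian f x - gradient f x *m (gradient f x)^T) *m h) 0 0 =
  'D_h ('D_h f) x - ('D_h f x) ^+ 2.
Proof.
move=> oU [df Df] Ux.
have dDf i : differentiable ('D_(delta_mx i 0) f) x.
  by have [+ _] := Df (delta_mx i 0); apply.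
have gE : ((gradient f x)^T *m h) 0 0 = 'D_h f x.
  rewrite (derive_sum_partial h (df x Ux)) mxE; apply: eq_bigr => i _.
  by rewrite !mxE mulrC.
have gE' : (h^T *m gradient f x) 0 0 = 'D_h f x.
  by rewrite -gE !mxE; apply: eq_bigr => i _; rewrite !mxE mulrC.
have hE : (h^T *m hessian f x *m h) 0 0 = 'D_h ('D_h f) x.
  (* The expansion of the first derivative in partials holds throughout [U], hence can itself be
     differentiated along [h]. *)
  rewrite (@eq_on_derive _ _ _ oU _
    (\sum_i (h i 0 *: 'D_(delta_mx i 0) f)) h _ x Ux); last first.
    by move=> y Uy; rewrite fct_sumE (derive_sum_partial h (df y Uy)).
  rewrite derive_sum => [|i]; last by apply: derivableZ; exact: diff_derivable.
  rewrite mxE; apply: eq_bigr => j _.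
  rewrite deriveZ; last exact: diff_derivable.
  rewrite (derive_sum_partial h (dDf j)) /GRing.scale /= mulrC; congr (_ * _).
  by rewrite mxE; apply: eq_bigr => i _; rewrite !mxE.
rewrite mulmxBr mulmxBl [h^T *m (gradient f x *m _)]mulmxA.
rewrite -[h^T *m gradient f x *m _ *m h]mulmxA.
by rewrite [LHS]mxE [X in _ + X]mxE hE mxE big_ord1 gE gE' expr2.
Qed.

Section affine_functions.
Context {R : realType} {n : nat}.
Variables (p l : {linear 'cV[R]_n -> R^o}) (r0 : R).
Implicit Types z u v : 'cV[R]_n.

Local Notation r z := (r0 + l z).

Lemma is_derive_affine z v : is_derive z v (fun z => r z) (l v).
Proof.
have dl := linear_cV_differentiable l z.
have h : is_derive z v (l : _ -> R) (l v).
  by split; [exact: diff_derivable|exact: derive_linear_cV].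
have := is_deriveD (is_derive_cst r0 z v) h; rewrite add0r; exact.
Qed.

Lemma is_derive_affineV z v : r z != 0 ->
  is_derive z v (fun z => (r z)^-1) (- (r z) ^- 2 * l v).
Proof.
move=> rz; have [d e] := is_derive_affine z v; split.
  exact: derivableV.
by rewrite deriveV // e.
Qed.

Variable U : set 'cV[R]_n.
Hypotheses (oU : open U) (rU : forall z, U z -> 0 < r z).

Let r_neq0 z : U z -> r z != 0.
Proof. by move=> /rU; exact: lt0r_neq0. Qed.

Lemma Ck_affine k : Ck k U (fun z => r z).
Proof. by apply: CkD => //; [exact: Ck_cst|exact: Ck_linear]. Qed.

Lemma derive_affine_ratio c v z : U z ->
  'D_v (fun z => c + (r z)^-1 * p z) z =
  (r z)^-1 * p v - (r z) ^- 2 * l v * p z.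
Proof.
move=> Uz; have dp : is_derive z v (p : _ -> R) (p v).
  split; last exact: derive_linear_cV.
  exact/diff_derivable/linear_cV_differentiable.
have [_ ->] := is_deriveD (is_derive_cst c z v)
  (is_deriveM (is_derive_affineV v (r_neq0 Uz)) dp).
by rewrite /GRing.scale /=; ring.
Qed.

(** The point of the explicit formula is its visible symmetry in [u] and [v], as required of the
    coordinates of [psi] by [derive2_comp_sym]. *)
Lemma derive2_affine_ratio c u v z : U z ->
  'D_u ('D_v (fun z => c + (r z)^-1 * p z)) z =
  2 * (r z) ^- 3 * l u * l v * p z
  - (r z) ^- 2 * (l u * p v + l v * p u).
Proof.
move=> Uz; have dp : is_derive z u (p : _ -> R) (p u).
  split; last exact: derive_linear_cV.
  exact/diff_derivable/linear_cV_differentiable.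
rewrite (@eq_on_derive _ _ _ oU _ _ _ (derive_affine_ratio c v) _ Uz).
have dV := is_derive_affineV u (r_neq0 Uz).
have [_ e] := is_deriveB (is_deriveM dV (is_derive_cst (p v) z u))
  (is_deriveM (is_deriveM (is_deriveX 2 dV) (is_derive_cst (l v : R) z u)) dp).
rewrite (_ : (fun _ => _) = (fun z => (r z)^-1) * cst (p v)
  - (fun z => (r z)^-1) ^+ 2 * cst (l v : R) * p); last first.
  by apply/funext => y; rewrite !fctE /= exprVn.
rewrite e !fctE /GRing.scale /=.
by have := r_neq0 Uz => ?; field.
Qed.

Lemma derive2_ln_affine u v z : U z ->
  'D_u ('D_v (fun z => ln (r z))) z = - (r z) ^- 2 * l u * l v.
Proof.
move=> Uz.
rewrite (@eq_on_derive _ _ _ oU _ (fun z => (r z)^-1 * l v) _ _ _ Uz).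
  have [_ e] := is_deriveM (is_derive_affineV u (r_neq0 Uz))
    (is_derive_cst (l v : R) z u).
  by rewrite [LHS]e /GRing.scale /=; ring.
move=> y Uy; rewrite derive_ln ?rU //; last first.
  by have [+ _] := Ck_affine 1; apply.
by have [_ ->] := is_derive_affine y v.
Qed.

End affine_functions.

(** * The projective change of variables *)

(** Bundling a coordinate of [M] as a linear form makes each coordinate of [psi] an affine ratio in
    the sense above. *)
Lemma linear_coord (R : realType) (n : nat)
    (M : {linear 'cV[R]_n -> 'cV[R]_n}) (i : 'I_n) :
  exists p : {linear 'cV[R]_n -> R^o}, forall z, p z = M z i 0.
Proof.
suff h : linear (fun z => M z i 0 : R^o).
  pose H := GRing.isLinear.Build R 'cV[R]_n R^o _ _ h.
  pose p : {linear 'cV[R]_n -> R^o} := HB.pack (fun z => M z i 0 : R^o) H.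
  by exists p.
by move=> a u v; rewrite linearP !mxE.
Qed.

(** The substitutions form a one-parameter group in [rho], and the two expressions are the values of
    [g2] and [g3] at the parameter [rho = f1] that normalises [g1] to 0; hence their invariance. *)
Lemma psc_invariants (R : comPzRingType) (rho f1 f2 f3 g1 g2 g3 : R) :
  g1 = f1 - rho -> g2 = f2 - 2 * rho * f1 + rho ^+ 2 ->
  g3 = f3 - 6 * rho * f2 + 6 * rho ^+ 2 * f1 - 2 * rho ^+ 3 ->
  g2 - g1 ^+ 2 = f2 - f1 ^+ 2 /\
  g3 - 6 * g2 * g1 + 4 * g1 ^+ 3 = f3 - 6 * f2 * f1 + 4 * f1 ^+ 3.
Proof. by move=> -> -> ->; split; ring. Qed.

Section projective_change.
Context {R : realType} {n : nat}.
Local Notation V := 'cV[R]_n.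
Variables (M : {linear V -> V}) (l : {linear V -> R^o}) (r0 : R) (x0 : V).

Local Notation r z := (r0 + l z).
(** The data [M], [l], [r0], [x0] are arbitrary here; [proj_map_inv] later chooses them so that this
    inverts [proj_map A q]. In the application [X] and [U] below are the interiors of the two convex
    sets. *)
Definition proj_inv z := x0 + (r z)^-1 *: M z.
Local Notation psi := proj_inv.

Variables (X U : set V) (f g : V -> R).
Hypothesis oU : open U.
Hypothesis rU : forall z, U z -> 0 < r z.
Hypothesis psiU : forall z, U z -> X (psi z).
Hypothesis Cf : Ck 3 X f.
Hypothesis gE : forall z, U z -> g z = f (psi z) - ln (r z).

Lemma proj_inv_coord i : exists p : {linear V -> R^o},
  (fun z => psi z i 0) = (fun z => x0 i 0 + (r z)^-1 * p z).
Proof.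
have [p pE] := linear_coord M i; exists p.
by apply/funext => z; rewrite !mxE pE.
Qed.

Lemma Ck_proj_inv k i : Ck k U (fun z => psi z i 0).
Proof.
have [p ->] := proj_inv_coord i.
apply: CkD => //; first exact: Ck_cst.
apply: CkM => //; last exact: Ck_linear.
by apply: CkV => [//|z Uz|]; [rewrite gt_eqF ?rU|exact: Ck_affine].
Qed.

Lemma Ck_proj_transform : Ck 3 U g.
Proof.
apply: (@Ck_eq _ _ _ oU 3 (fun z => f (psi z) + -1 * ln (r z))).
  by move=> z Uz; rewrite gE // mulN1r.
apply: CkD => //; first by apply: (Ck_comp oU psiU) => // i; exact: Ck_proj_inv.
apply: CkM => //; first exact: Ck_cst.
by apply: Ck_ln => //; exact: Ck_affine.
Qed.

(** [posdefmx] includes symmetry. It is inherited from the Hessian of [f] for the composite with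
    [psi], and read off an explicit formula for log r. *)
Lemma hessian_proj_transform_sym z : U z ->
  (hessian f (psi z))^T = hessian f (psi z) ->
  (hessian g z)^T = hessian g z.
Proof.
move=> Uz /matrixP fsym.
have Cpsi i : Ck 2 U (fun z => psi z i 0) by exact: Ck_proj_inv.
have Ccomp : Ck 2 U (f \o psi) by apply: (Ck_comp oU psiU Cpsi); exact: CkW.
have Cln : Ck 2 U (fun z => ln (r z)).
  exact: (Ck_ln oU rU (Ck_affine l r0 oU 2)).
have H u v : 'D_u ('D_v g) z =
    'D_u ('D_v (f \o psi)) z - 'D_u ('D_v (fun z => ln (r z))) z.
  have [d1 D1] := Ccomp; have [d2 D2] := Cln.
  have [d1' _] := D1 v; have [d2' _] := D2 v.
  rewrite (@eq_on_derive _ _ _ oU _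
    ('D_v (f \o psi) - 'D_v (fun z => ln (r z))) u _ z Uz).
    by rewrite deriveB //; apply: diff_derivable; [exact: d1'|exact: d2'].
  move=> y Uy; rewrite (@eq_on_derive _ _ _ oU _
    ((f \o psi) - (fun z => ln (r z))) v _ y Uy).
    by rewrite deriveB //; apply: diff_derivable; [exact: d1|exact: d2].
  by move=> w Uw; rewrite gE.
have Hln u v : 'D_u ('D_v (fun z => ln (r z))) z =
    'D_v ('D_u (fun z => ln (r z))) z.
  rewrite [LHS](derive2_ln_affine oU rU u v Uz).
  by rewrite [RHS](derive2_ln_affine oU rU v u Uz); ring.
have Hcomp u v : 'D_u ('D_v (f \o psi)) z = 'D_v ('D_u (f \o psi)) z.
  apply: (derive2_comp_sym oU psiU Cpsi (CkW Cf) Uz) => [i|i j].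
    have [p ->] := proj_inv_coord i.
    rewrite [LHS](derive2_affine_ratio p oU rU _ u v Uz).
    by rewrite [RHS](derive2_affine_ratio p oU rU _ v u Uz); ring.
  by have := fsym j i; rewrite mxE [LHS]mxE [RHS]mxE.
have S u v : 'D_u ('D_v g) z = 'D_v ('D_u g) z.
  apply: etrans (H u v) (etrans _ (esym (H v u))).
  exact: (congr2 (fun a b => a - b) (Hcomp u v) (Hln u v)).
by apply/matrixP => i j; rewrite mxE [LHS]mxE [RHS]mxE; exact: S.
Qed.

Section direction.
Variables (z k : V).
Hypothesis Uz : U z.

Let rho := l k / r z.
Let h := (r z)^-1 *: (M k - rho *: M z).

Let r_neq0 : r z != 0. Proof. exact/lt0r_neq0/rU. Qed.

Lemma affine_line t : r (z + t *: k) = r z * (1 + rho * t).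
Proof.
rewrite linearD linearZ /rho mulrDr mulr1 mulrA [_ * (l k / _)]mulrC divfK //.
by rewrite mulrC addrA.
Qed.

(** Over the common denominator r(z)(1 + rho t), the difference of the two fractions has numerator t
    (M k - rho M z). *)
Lemma proj_inv_line t : 1 + rho * t != 0 ->
  psi (z + t *: k) = psi z + tau rho t *: h.
Proof.
move=> den; rewrite /proj_inv affine_line /h /tau -addrA; congr (_ + _).
apply/matrixP => i j; rewrite linearD linearZ !mxE.
by field; rewrite den r_neq0.
Qed.

Let T : set R := [set t | U (z + t *: k)].

Let T0 : T 0. Proof. by rewrite /T /= scale0r addr0. Qed.

Let oT : open T.
Proof.
apply: (@open_comp _ _ (fun t : R => z + t *: k)) => // t _.
suff : z + s *: k @[s --> t] --> z + t *: k by [].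
by apply: cvgD; [exact: cvg_cst|apply: cvgZr_tmp; exact: cvg_id].
Qed.

Let Tpos t : T t -> 0 < 1 + rho * t.
Proof. by move=> /rU; rewrite affine_line pmulr_rgt0 // rU. Qed.

Let psiT t : T t -> X (psi z + tau rho t *: h).
Proof.
by move=> Tt; rewrite -proj_inv_line ?lt0r_neq0 ?Tpos //; exact: psiU.
Qed.

Let F (w : V -> R) (s : R) := w (psi z + s *: h).
Let G (w : V -> R) (t : R) := w (z + t *: k).

Let dF (w : V -> R) t : (forall x, X x -> differentiable w x) -> T t ->
  is_derive (tau rho t) 1 (F w) (F ('D_h w) (tau rho t)).
Proof. by move=> dw Tt; apply/is_derive_line/dw/psiT. Qed.

Let dG (w : V -> R) t : (forall x, U x -> differentiable w x) -> T t ->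
  is_derive t 1 (G w) (G ('D_k w) t).
Proof. by move=> dw Tt; apply/is_derive_line/dw. Qed.

(** The logarithm of the product r(z)(1 + rho t) splits; the part independent of t becomes the
    additive constant [c] of the one-variable computation. *)
Let GF t : T t -> G g t = F f (tau rho t) - ln (1 + rho * t) + - ln (r z).
Proof.
move=> Tt; rewrite /G /F gE // proj_inv_line ?lt0r_neq0 ?Tpos //.
rewrite affine_line lnM ?posrE ?rU ?Tpos //.
by rewrite opprD addrA addrAC.
Qed.

Lemma directional_proj_transform :
  [/\ 'D_k g z = 'D_h f (psi z) - rho,
      'D_k ('D_k g) z = 'D_h ('D_h f) (psi z) - 2 * rho * 'D_h f (psi z)
        + rho ^+ 2
    & 'D_k ('D_k ('D_k g)) z = 'D_h ('D_h ('D_h f)) (psi z)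
        - 6 * rho * 'D_h ('D_h f) (psi z)
        + 6 * rho ^+ 2 * 'D_h f (psi z) - 2 * rho ^+ 3].
Proof.
have [df0 /(_ h)[df1 /(_ h)[df2 _]]] := Cf.
have [dg0 /(_ k)[dg1 /(_ k)[dg2 _]]] := Ck_proj_transform.
have dF0 t := @dF _ t df0; have dF1 t := @dF _ t df1.
have dF2 t := @dF _ t df2.
have dG0 t := @dG _ t dg0; have dG1 t := @dG _ t dg1.
have dG2 t := @dG _ t dg2.
have FE w : F w 0 = w (psi z) by rewrite /F scale0r addr0.
have GE w : G w 0 = w z by rewrite /G scale0r addr0.
exact: (line_derives_at0 oT Tpos dF0 dF1 dF2 dG0 dG1 dG2 GF T0
  (FE _) (FE _) (FE _) (GE _) (GE _) (GE _)).
Qed.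

Lemma psc_quantities_proj_transform :
  'D_k ('D_k g) z - ('D_k g z) ^+ 2 =
    'D_h ('D_h f) (psi z) - ('D_h f (psi z)) ^+ 2 /\
  'D_k ('D_k ('D_k g)) z - 6 * 'D_k ('D_k g) z * 'D_k g z
    + 4 * ('D_k g z) ^+ 3 =
  'D_h ('D_h ('D_h f)) (psi z) - 6 * 'D_h ('D_h f) (psi z) * 'D_h f (psi z)
    + 4 * ('D_h f (psi z)) ^+ 3.
Proof.
by have [e1 e2 e3] := directional_proj_transform; exact: psc_invariants e1 e2 e3.
Qed.

(** If [h] vanished, [psi] would be constant along the line near [z], against the left inverse
    [phi]. *)
Lemma direction_neq0 (phi : V -> V) :
  (forall y, 0 < r y -> phi (psi y) = y) -> k != 0 -> h != 0.
Proof.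
move=> psiK k0; apply/eqP => h0.
(* The open set [T] contains 0, hence also some nonzero parameter. *)
have : \forall t \near (0 : R)^', T t by exact/nbhs_dnbhs/open_nbhs_nbhs.
move=> nT; have [t [Tt t0]] : exists t, T t /\ t != 0.
  apply: (@filter_ex _ (0 : R)^' _ (fun t => T t /\ t != 0)).
  exact: filterI nT (nbhs_dnbhs_neq (0 : R)).
have := proj_inv_line (lt0r_neq0 (Tpos Tt)).
rewrite h0 scaler0 addr0 => /(congr1 phi); rewrite !psiK ?rU //.
move=> /eqP; rewrite -subr_eq0 addrAC subrr add0r scaler_eq0.
by rewrite (negbTE t0) (negbTE k0).
Qed.

End direction.

End projective_change.

(** * The inverse projective map and the interior of the image *)

Lemma affine_linear_continuous (R : realType) (n : nat) (W : normedModType R)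
    (F : 'cV[R]_n -> W) : affine_linear F -> continuous F.
Proof.
move=> [L [b FE]] x; rewrite (_ : F = fun y => L y + b); last exact/funext.
apply: (@cvgD _ _ _ (nbhs x) _ L (fun=> b)); last exact: cvg_cst.
exact/differentiable_continuous/linear_cV_differentiable.
Qed.

Section inverse_projective_map.
Context {R : realType} {n : nat}.
Local Notation V := 'cV[R]_n.
Variables (q : V -> R) (A : V -> V).
Hypotheses (hq : affine_linear (q : V -> R^o)) (hA : affine_linear A).
Hypotheses (hA_iso : bijective A) (hqA : ~ exists x, q x = 0 /\ A x = 0).

(** Let x0 be the zero of A, d = q(x0), M the inverse of the linear part of A and lq the linear part
    of q. For z = A(x)/q(x) one has M z = (x - x0)/q(x), so lq(M z) = 1 - d/q(x). Solving gives
    1/q(x) = 1/d - lq(M z)/d, which dictates [r0] and [l]. *)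
Lemma proj_map_inv : exists (M : {linear V -> V}) (l : {linear V -> R^o})
    (r0 : R) (x0 : V),
  (forall x, 0 < q x -> 0 < r0 + l (proj_map A q x) /\
     proj_inv M l r0 x0 (proj_map A q x) = x) /\
  (forall z, 0 < r0 + l z -> q (proj_inv M l r0 x0 z) = (r0 + l z)^-1 /\
     proj_map A q (proj_inv M l r0 x0 z) = z).
Proof.
have [lq [bq qE]] := hq; have [LA [bA AE]] := hA; have [Ai AK AiK] := hA_iso.
have lqZ a u : lq (a *: u) = a * lq u by rewrite linearZ.
pose x0 := Ai 0; pose d := q x0.
(* This is where the absence of common zeros enters; the sign of [d] remains undetermined. *)
have d0 : d != 0 by apply/eqP => d0; apply: hqA; exists x0; rewrite AiK.
have Ax0 u : A (x0 + u) = LA u.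
  by rewrite AE linearD addrAC -AE AiK add0r.
have qx0 u : q (x0 + u) = d + lq u.
  by rewrite /d !qE linearD addrAC.
pose m z := Ai z - x0.
have Am z : LA (m z) = z by rewrite -Ax0 /m addrC subrK AiK.
have mA u : m (LA u) = u by rewrite -Ax0 /m AK addrC addKr.
have lin_m : linear m.
  by move=> a u v; rewrite -{1}(Am u) -{1}(Am v) -linearP mA.
pose HM := GRing.isLinear.Build R V V _ m lin_m.
pose M : {linear V -> V} := HB.pack m HM.
have lin_l : linear (fun z => - (d^-1 * lq (m z)) : R^o).
  by move=> a u v; rewrite lin_m linearP /GRing.scale /=; ring.
pose Hl := GRing.isLinear.Build R V R^o _ _ lin_l.
pose l : {linear V -> R^o} := HB.pack (fun z => - (d^-1 * lq (m z)) : R^o) Hl.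
have lE z : l z = - (d^-1 * lq (M z)) by [].
exists M, l, d^-1, x0; split=> [x qx|z rz].
  have qx0' : q x != 0 by rewrite gt_eqF.
  have Mphi : M (proj_map A q x) = (q x)^-1 *: (x - x0).
    by rewrite /proj_map linearZ /= /m AK.
  have lqx : lq (x - x0) = q x - d.
    have := qx0 (x - x0); rewrite addrC subrK => ->.
    by rewrite addrAC subrr add0r.
  have rE : d^-1 + l (proj_map A q x) = (q x)^-1.
    rewrite lE Mphi lqZ lqx.
    by field; rewrite d0 qx0'.
  rewrite rE invr_gt0; split=> //.
  by rewrite /proj_inv rE Mphi invrK scalerA divff // scale1r addrC subrK.
have rz0 := lt0r_neq0 rz; rewrite /proj_inv.
have qE' : q (x0 + (d^-1 + l z)^-1 *: M z) = (d^-1 + l z)^-1.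
  rewrite qx0 lqZ.
  have -> : lq (M z) = - (d * l z) by rewrite lE mulrN mulVKf // opprK.
  apply: (mulIf rz0); rewrite mulVf // mulrDl mulrAC mulVf // mul1r.
  by rewrite mulrDr divff // addrK.
split=> //; rewrite /proj_map qE' invrK Ax0 linearZ /= Am scalerA divff //.
by rewrite scale1r.
Qed.

Lemma proj_map_continuous x : 0 < q x -> {for x, continuous (proj_map A q)}.
Proof.
move=> qx; have cq : q y @[y --> x] --> q x.
  exact: (affine_linear_continuous hq).
have cA : A y @[y --> x] --> A x by exact: affine_linear_continuous.
exact: (cvgZ (cvgV (lt0r_neq0 qx) cq) cA).
Qed.

End inverse_projective_map.

Lemma proj_inv_continuous (R : realType) (n : nat)
    (M : {linear 'cV[R]_n -> 'cV[R]_n}) (l : {linear 'cV[R]_n -> R^o})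
    (r0 : R) (x0 z : 'cV[R]_n) : r0 + l z != 0 ->
  {for z, continuous (proj_inv M l r0 x0)}.
Proof.
move=> rz.
have cl : l y @[y --> z] --> l z.
  exact/differentiable_continuous/linear_cV_differentiable.
have cr : r0 + l y @[y --> z] --> r0 + l z by exact: (cvgD (cvg_cst r0) cl).
have cM : M y @[y --> z] --> M z.
  exact/differentiable_continuous/linear_cV_differentiable.
exact: (cvgD (cvg_cst x0) (cvgZ (cvgV rz cr) cM)).
Qed.

(** The maps [proj_map A q] and [psi] are mutually inverse and continuous between the open
    half-spaces q > 0 and r > 0, so each pulls neighbourhoods back to neighbourhoods. *)
Lemma proj_image_interior (R : realType) (n : nat) (X : set 'cV[R]_n)
    (q : 'cV[R]_n -> R) (A : 'cV[R]_n -> 'cV[R]_n)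
    (M : {linear 'cV[R]_n -> 'cV[R]_n}) (l : {linear 'cV[R]_n -> R^o})
    (r0 : R) (x0 : 'cV[R]_n) (psi := proj_inv M l r0 x0) :
  affine_linear (q : 'cV[R]_n -> R^o) -> affine_linear A ->
  (forall x, 0 < q x -> 0 < r0 + l (proj_map A q x) /\
     psi (proj_map A q x) = x) ->
  (forall z, 0 < r0 + l z -> q (psi z) = (r0 + l z)^-1 /\
     proj_map A q (psi z) = z) ->
  (proj_image A q X)° = [set z | 0 < r0 + l z /\ X° (psi z)].
Proof.
move=> hq hA psiK phiK; apply/seteqP; split=> z /=.
  move=> Xz; have [x [Xx qx] phix] := interior_subset Xz.
  have [rz psix] := psiK x qx; rewrite -phix; split=> //.
  rewrite psix.
  have cphi := proj_map_continuous hq hA qx.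
  have cq : q y @[y --> x] --> q x by exact: (affine_linear_continuous hq).
  have n1 : \forall y \near x, proj_image A q X (proj_map A q y).
    by apply: cphi; rewrite phix.
  have n2 : \forall y \near x, 0 < q y by exact: cvgr_gt cq _ qx.
  (* A nearby y has the same image as some w in X; applying [psi] identifies y with w. *)
  apply: filterS2 n1 n2 => y [w [Xw qw] phiw] qy.
  by have [_ <-] := psiK y qy; have [_ ww] := psiK w qw; rewrite -phiw ww.
move=> [rz Xz].
have cl : l y @[y --> z] --> l z.
  exact/differentiable_continuous/linear_cV_differentiable.
have cr : r0 + l y @[y --> z] --> r0 + l z by exact: (cvgD (cvg_cst r0) cl).
have n1 : \forall y \near z, 0 < r0 + l y by exact: cvgr_gt cr _ rz.
have n2 : \forall y \near z, X (psi y).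
  by apply: (proj_inv_continuous (lt0r_neq0 rz)); exact: Xz.
apply: filterS2 n1 n2 => y ry Xy.
have [qy phiy] := phiK y ry; exists (psi y) => //; split=> //.
by rewrite qy invr_gt0.
Qed.

(** * Verification of the barrier conditions for the transform *)

Theorem mainTheorem7 (R : realType) (n : nat) (X : set 'cV[R]_n)
    (f : 'cV[R]_n -> R) (gamma : R)
    (q : 'cV[R]_n -> R) (A : 'cV[R]_n -> 'cV[R]_n)
    (hX : regular_convex X)
    (hf : psc_barrier X f gamma)
    (hq : affine_linear (q : 'cV[R]_n -> R^o))
    (hA : affine_linear A)
    (hA_iso : bijective A)
    (hqA : ~ exists x : 'cV[R]_n, q x = 0 /\ A x = 0)
    (hX' : regular_convex (proj_image A q X)) :
  (exists g : 'cV[R]_n -> R, is_proj_transform A q X f g) /\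
  (forall g : 'cV[R]_n -> R, is_proj_transform A q X f g ->
     psc_barrier (proj_image A q X) g gamma).
Proof.
have [M [l [r0 [x0 [psiK phiK]]]]] := proj_map_inv hq hA hA_iso hqA.
set psi := proj_inv M l r0 x0 in psiK phiK.
split.
  (* Since [psi] recovers x from its image, this prescription is consistent. *)
  exists (fun z => f (psi z) + ln (q (psi z))) => x _ qx.
  by have [_ ->] := psiK x qx.
move=> g gT; have [gamma0 [Cf pdf limf thirdf]] := hf.
have UE := proj_image_interior X hq hA psiK phiK.
set U := (proj_image A q X)° in UE *.
have oU : open U by exact: open_interior.
have rU z : U z -> 0 < r0 + l z by rewrite UE => -[].
have psiU z : U z -> X° (psi z) by rewrite UE => -[].
have gE z : U z -> g z = f (psi z) - ln (r0 + l z).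
  move=> Uz; have [qz phiz] := phiK z (rU z Uz).
  rewrite -[in LHS]phiz gT ?qz ?invr_gt0 ?rU //; last exact: psiU.
  by rewrite lnV // posrE rU.
have Cg : Ck 3 U g := Ck_proj_transform oU rU psiU Cf gE.
have quant z k (Uz : U z) :=
  psc_quantities_proj_transform oU rU psiU Cf gE k Uz.
have oX : open X° := open_interior X.
split=> //; split=> //.
- move=> z Uz; split.
    have [fsym _] := pdf _ (psiU z Uz).
    have hfsym : (hessian f (psi z))^T = hessian f (psi z).
      (* The rank-one term is symmetric, so it cancels from the symmetry of the difference. *)
      by move: fsym; rewrite linearB /= trmx_mul trmxK => /addIr.
    rewrite linearB /= trmx_mul trmxK; congr (_ - _).
    exact: (hessian_proj_transform_sym oU rU psiU Cf gE).
  move=> k k0; rewrite (psc_form_quadratic k oU (CkW Cg) Uz).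
  (* The quadratic form of [g] at [k] equals that of [f] at the transported direction, which is
     nonzero by [direction_neq0]. *)
  have [e2 _] := quant z k Uz; apply: (eq_ind_r (fun t => 0 < t) _ e2).
  rewrite -(psc_form_quadratic _ oX (CkW Cf) (psiU z Uz)).
  have [_ pd] := pdf _ (psiU z Uz); apply: pd.
  apply: (direction_neq0 oU rU Uz _ k0) => y ry.
  by have [_] := phiK y ry; exact.
- move=> u z Uu [Xz nUz] uz.
  have [cX' _ _ _] := hX'.
  (* Closedness puts the boundary point in the image, so it comes from a point with q > 0: there r
     is positive, [psi] is continuous and log r has a finite limit. *)
  have [x [Xx qx] phix] : proj_image A q X z by apply: cX'.
  have [rz psiz] := psiK x qx; rewrite phix in rz psiz.
  have cpsi := proj_inv_continuous (M := M) (x0 := x0) (lt0r_neq0 rz).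
  have psiu : psi (u k) @[k --> \oo] --> x.
    by rewrite -psiz; exact: cvg_comp uz cpsi.
  have bx : boundary X x.
    split; first exact: subset_closure.
    (* Were x interior to X, the description [UE] of the interior would place z in it. *)
    by move=> Xox; apply: nUz; rewrite -/U UE; split=> //; rewrite -/psi psiz.
  have fu := limf (psi \o u) x (fun k => psiU _ (Uu k)) bx psiu.
  have cl : {for z, continuous l}.
    exact/differentiable_continuous/linear_cV_differentiable.
  have cr : r0 + l (u k) @[k --> \oo] --> r0 + l z.
    have clu : l (u k) @[k --> \oo] --> l z by exact: (cvg_comp _ _ uz cl).
    exact: (cvgD (cvg_cst r0) clu).
  have lu : ln (r0 + l (u k)) @[k --> \oo] --> ln (r0 + l z).
    exact: cvg_comp cr (continuous_ln rz).
  rewrite (_ : (fun k => g (u k)) =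
    (fun k => f (psi (u k)) - ln (r0 + l (u k)))); last first.
    by apply/funext => k; exact: gE (Uu k).
  (* Eventually log r stays below its limit plus 1, so raising the bound on [f] by that amount
     absorbs it. *)
  apply/cvgryPge => B; move/cvgryPge: fu => /(_ (B + (ln (r0 + l z) + 1))) n1.
  have n2 : \forall k \near \oo, ln (r0 + l (u k)) < ln (r0 + l z) + 1.
    by apply: cvgr_lt lu _ _; rewrite ltrDl.
  apply: filterS2 n1 n2 => k; rewrite /= => fk lk.
  by rewrite lerBrDr; apply: le_trans fk; rewrite lerD2l; exact: ltW.
- move=> z k Uz; have [e2 e3] := quant z k Uz.
  (* Both sides of the inequality are the invariant quantities of [f] at [psi z] along the
     transported direction, so [gamma] is unchanged. *)
  apply: (eq_ind_r (fun t => `|t| <= _) _ e3).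
  apply: (eq_ind_r (fun t => _ <= 2 * gamma * t `^ (3 / 2)) _ e2).
  exact: (thirdf _ _ (psiU z Uz)).
Qed.
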